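(* Let $G=(V,E)$ be a finite undirected graph with $N=|V|$ nodes whose node set is partitioned into a set $\mathcal{C}$ of categories, let $A\in\mathcal{C}$, and let $S$ be a uniform independence sample of size $n$ from $V$. Define $$\widehat{k}_V=\frac{\sum_{v\in S}\deg(v)}{|S|},\qquad \widehat{k}_A=\frac{\sum_{v\in S_A}\deg(v)}{|S_A|},\qquad \widehat{f}^{\mathrm{vol}}_A=\frac{1}{\mathrm{vol}(S)}\sum_{s\in S}\sum_{v\in\mathcal{N}(s)}1_{\{v\in A\}}.$$ Then the star estimator of category size $$|\widehat{A}| = N\cdot \widehat{f}^{\mathrm{vol}}_A\cdot\frac{\widehat{k}_V}{\widehat{k}_A}$$ is consistent for $|A|$, i.e. $|\widehat{A}|\to|A|$ in probability as $n\to\infty$.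
   Context: Uniform independence sampling (UIS): nodes are drawn independently and with replacement from $V$, each node having the same sampling probability; $S$ is the resulting multiset of $n=|S|$ nodes, and all sums over $S$ and sizes count multiplicity. $S_A=\{v\in S: v\in A\}$ is the multiset of samples from $A$. $\mathcal{N}(s)$ is the set of neighbors of $s$ in $G$, $\deg(s)$ is the degree of $s$, and $\mathrm{vol}(S)=\sum_{s\in S}\deg(s)$. The estimator comes from the identity $f^{\mathrm{vol}}_A=\mathrm{vol}(A)/\mathrm{vol}(V)=|A|\,k_A/(N\,k_V)$, where $\mathrm{vol}(A)=\sum_{v\in A}\deg(v)$ (and likewise for $V$), and $k_A$, $k_V$ are the average node degrees in $A$ and in $V$. The assumption made for consistency under uniform sampling is that the relevant means and variances are finite, which holds for finite graphs. $G$ and $N$ are fixed. *)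

(* Defs.v *)
From HB Require Import structures.
From mathcomp Require Import all_boot all_order all_algebra.
From mathcomp Require Import all_classical all_reals all_analysis.
Set Implicit Arguments.
Unset Strict Implicit.
Unset Printing Implicit Defensive.
Import Order.TTheory GRing.Theory Num.Theory.
Import numFieldNormedType.Exports.
Local Open Scope ring_scope.

(* An undirected graph on the finite node set V is a symmetric relation e.
   Irreflexivity is never required: simple graphs are a special case, and a
   loop, if present, makes its node a neighbor of itself and counts once in
   the degree. *)

Definition neighbors (V : finType) (e : rel V) (v : V) : {set V} :=
  finset (e v).

Definition deg (V : finType) (e : rel V) (v : V) : nat := #|neighbors e v|.

Definition vol (V : finType) (e : rel V) (A : {set V}) : nat :=
  (\sum_(v in A) deg e v)%N.

(* Samples are multisets of nodes, represented by sequences: all sums and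
   sizes below count multiplicity, and none of them depends on the order. *)

Definition sample_vol (V : finType) (e : rel V) (s : seq V) : nat :=
  (\sum_(v <- s) deg e v)%N.

Definition sample_in (V : finType) (A : {set V}) (s : seq V) : seq V :=
  [seq v <- s | v \in A].

(* \hat k_V is [mean_deg R e s], \hat k_A is [mean_deg R e (sample_in A s)].
   In a field x / 0 = 0, so the estimators take the value 0 on those samples
   for which they are undefined. *)
Definition mean_deg (R : realType) (V : finType) (e : rel V) (s : seq V) : R :=
  (\sum_(v <- s) deg e v)%N%:R / (size s)%:R.

Definition fvol_hat (R : realType) (V : finType) (e : rel V) (A : {set V})
    (s : seq V) : R :=
  (sample_vol e s)%:R^-1
  * (\sum_(u <- s) \sum_(v in neighbors e u) (v \in A : nat))%N%:R.

Definition star_size (R : realType) (V : finType) (e : rel V) (A : {set V})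
    (s : seq V) : R :=
  #|V|%:R * fvol_hat R e A s
  * (mean_deg R e s / mean_deg R e (sample_in A s)).

(* The n draws recorded in S are V-valued random elements (V carrying its
   discrete sigma-algebra), mutually independent, and uniform on V. *)
Definition uniform_independence_sample (R : realType) (d : measure_display)
    (Omega : measurableType d) (P : probability Omega R) (V : finType)
    (n : nat) (S : Omega -> n.-tuple V) : Prop :=
  [/\ (forall (i : 'I_n) (B : {set V}),
         measurable [set w | tnth (S w) i \in B]%classic),
      (forall (i : 'I_n) (v : V),
         P [set w | tnth (S w) i = v]%classic = (#|V|%:R^-1)%:E) &
      (forall (J : {set 'I_n}) (B : 'I_n -> {set V}),
         P [set w | forall i, i \in J -> tnth (S w) i \in B i]%classic
         = (\prod_(i in J) P [set w | tnth (S w) i \in B i]%classic)%E)].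

(* Convergence in probability of X n to the constant l as n tends to infinity. *)
Definition cvg_in_probability (R : realType) (d : measure_display)
    (Omega : measurableType d) (P : probability Omega R)
    (X : nat -> Omega -> R) (l : R) : Prop :=
  forall eps : R, 0 < eps ->
    ((fun n => P [set w | eps < `|X n w - l|]%classic) @ \oo --> 0%E)%classic.

(* Main.v *)
Require Import Defs.
From HB Require Import structures.
From mathcomp Require Import all_boot all_order all_algebra.
From mathcomp Require Import all_classical all_reals all_analysis.
From mathcomp Require Import ring lra.
Set Implicit Arguments.
Unset Strict Implicit.
Unset Printing Implicit Defensive.
Import Order.TTheory GRing.Theory Num.Theory.
Import numFieldNormedType.Exports.
Local Open Scope ring_scope.

(** Whenever the sample is nonempty, vol(S) and |S| cancel and the estimator
    equals N X Y / Z, where X, Y, Z are the sample means of |N(v) :&: A|,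
    1_A(v) and 1_A(v) deg(v); this survives the convention x / 0 = 0.  The
    law of the sample is uniform on n-tuples, so the mean squared error of
    each sample mean is an exact O(1/n) by counting.  By symmetry of the
    graph the limits are vol(A)/N, |A|/N and vol(A)/N; continuity of
    (x, y, z) |-> x y / z at that point together with Markov's inequality
    for the sum of the three squared errors concludes. *)

Lemma sum_tuple_cons (M : nmodType) (V : finType) n (F : n.+1.-tuple V -> M) :
  \sum_t F t = \sum_v \sum_(t : n.-tuple V) F (cons_tuple v t).
Proof.
rewrite pair_bigA /=.
rewrite (reindex (fun p : V * n.-tuple V => cons_tuple p.1 p.2)) //=.
exists (fun t : n.+1.-tuple V => (thead t, behead_tuple t)).
  move=> [v t] _ /=; congr (_, _); by apply: val_inj.
by move=> t _; rewrite [RHS]tuple_eta; apply: val_inj.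
Qed.

Lemma sum_tuple_sum_eq0 (R : realType) (V : finType) (h : V -> R) n :
  \sum_v h v = 0 -> \sum_(t : n.-tuple V) \sum_(v <- t) h v = 0.
Proof.
move=> h0; elim: n => [|n IH].
  by rewrite big1// => t _; rewrite tuple0 big_nil.
rewrite sum_tuple_cons.
under eq_bigr do under eq_bigr do rewrite big_cons.
under eq_bigr do rewrite big_split /= IH addr0 sumr_const.
by rewrite sumrMnl h0 mul0rn.
Qed.

(** Variances of independent centred draws add up. Splitting off the first draw and expanding the
    square, the cross term vanishes by [sum_tuple_sum_eq0]. The factor [#|V|%:R] on the left avoids
    the exponent [n - 1], so the induction can start at 0. *)
Lemma sum_tuple_sqr_sum (R : realType) (V : finType) (h : V -> R) n :
  \sum_v h v = 0 ->
  #|V|%:R * \sum_(t : n.-tuple V) (\sum_(v <- t) h v) ^+ 2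
  = n%:R * #|V|%:R ^+ n * \sum_v h v ^+ 2.
Proof.
move=> h0; elim: n => [|n IH].
  rewrite big1 ?mulr0 ?mul0r// => t _.
  by rewrite tuple0 big_nil expr0n.
rewrite sum_tuple_cons.
have step v : \sum_(t : n.-tuple V) (\sum_(x <- cons_tuple v t) h x) ^+ 2
    = #|V|%:R ^+ n * h v ^+ 2
      + \sum_(t : n.-tuple V) (\sum_(x <- t) h x) ^+ 2.
  under eq_bigr do rewrite big_cons sqrrD.
  rewrite !big_split /= sumr_const card_tuple -mulr_sumr.
  rewrite sum_tuple_sum_eq0// mulr0 !addr0 -[_ *+ (_ ^ _)]mulr_natl.
  by rewrite natrX.
under eq_bigr do rewrite step.
rewrite big_split /= -mulr_sumr sumr_const -[X in _ + X]mulr_natl IH.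
rewrite exprS -natr1; ring.
Qed.

(** The variance of a sample mean is the variance of one draw divided by [n]: the previous identity
    applied to the centred function [g v - m]. *)
Lemma sum_tuple_sqr_dev (R : realType) (V : finType) (g : V -> R) (m : R) n :
  (0 < #|V|)%N -> (0 < n)%N -> m = (\sum_v g v) / #|V|%:R ->
  #|V|%:R ^- n
    * \sum_(t : n.-tuple V) ((\sum_(v <- t) g v) / n%:R - m) ^+ 2
  = (\sum_v (g v - m) ^+ 2) / #|V|%:R / n%:R.
Proof.
move=> V0 n0 mE.
have VN : #|V|%:R != 0 :> R by rewrite pnatr_eq0 -lt0n.
have nN : n%:R != 0 :> R by rewrite pnatr_eq0 -lt0n.
have h0 : \sum_v (g v - m) = 0.
  by rewrite sumrB sumr_const -mulr_natl mE mulrC divfK// subrr.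
have devE (t : n.-tuple V) :
    (\sum_(v <- t) g v) / n%:R - m = (\sum_(v <- t) (g v - m)) / n%:R.
  rewrite sumrB mulrBl; congr (_ - _).
  by rewrite big_const_seq count_predT size_tuple iter_addr_0 -[m *+ n]mulr_natr mulfK.
under eq_bigr do rewrite devE expr_div_n.
rewrite -mulr_suml.
have := sum_tuple_sqr_sum n h0.
set a := \sum_(t : n.-tuple V) _; set b := \sum_v _ => ab.
have -> : a = n%:R * #|V|%:R ^+ n * b / #|V|%:R.
  by rewrite -ab mulrC mulKf.
have XN : #|V|%:R ^+ n != 0 :> R by rewrite expf_neq0.
by field; rewrite VN nN XN.
Qed.

Section sample_law.
Context (R : realType) (d : measure_display) (Omega : measurableType d).
Context (P : probability Omega R) (V : finType) (n : nat).
Context (S : Omega -> n.-tuple V) (US : uniform_independence_sample P S).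

Let sample_eqE (t : n.-tuple V) : [set w | S w = t]%classic
  = [set w | forall i, i \in [set: 'I_n]%SET ->
       tnth (S w) i \in [set tnth t i]%SET]%classic.
Proof.
apply/seteqP; split => w /= => [-> i _|H]; first by rewrite inE.
by apply: eq_from_tnth => i; have := H i (finset.in_setT _); rewrite inE => /eqP.
Qed.

Lemma measurable_sample_eq (t : n.-tuple V) :
  measurable [set w | S w = t]%classic.
Proof.
have [mS _ _] := US.
rewrite (_ : [set w | S w = t]%classic = (\bigcap_(i in [set: 'I_n])
   [set w | tnth (S w) i \in [set tnth t i]%SET])%classic).
  by apply: fin_bigcap_measurable => [|i _]; [exact: finite_finset | exact: mS].
rewrite sample_eqE; apply/seteqP; split => w /= H i _; apply: H => //.
by rewrite inE.
Qed.

(** Fixing the whole sample fixes every coordinate, so independence over the full index set gives a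
    product of [n] uniform probabilities. *)
Lemma prob_sample_eq (t : n.-tuple V) :
  P [set w | S w = t]%classic = (#|V|%:R ^- n)%:E.
Proof.
have [_ uS iS] := US.
rewrite sample_eqE iS.
under eq_bigr => i _.
  rewrite (_ : [set w | _]%classic = [set w | tnth (S w) i = tnth t i]%classic).
    rewrite uS; over.
  by apply/seteqP; split => w /=; rewrite inE => /eqP.
by rewrite prodEFin prodr_const cardsT card_ord exprVn.
Qed.

(** Markov's inequality in counting form: the event is a finite union of atoms of equal mass, and
    [h] dominates the indicator of [T]. *)
Lemma prob_sample_le (T : pred (n.-tuple V)) (h : n.-tuple V -> R) :
  (forall t, 0 <= h t) -> (forall t, T t -> 1 <= h t) ->
  (P [set w | T (S w)]%classic <= (#|V|%:R ^- n * \sum_t h t)%:E)%E.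
Proof.
move=> h0 h1.
rewrite (_ : [set w | T (S w)]%classic
   = \big[setU/set0]_(t in T) [set w | S w = t]%classic); last first.
  rewrite -bigcup_pred; apply/seteqP; split => w /=; first by exists (S w).
  by move=> [t Tt ->].
(* Measurability is carried through the induction because binary subadditivity asks for it at each
   union. *)
have [_] : measurable (\big[setU/set0]_(t in T) [set w | S w = t]%classic) /\
    (P (\big[setU/set0]_(t in T) [set w | S w = t]%classic)
     <= \sum_(t in T) P [set w | S w = t]%classic)%E.
  elim/big_ind2 : _ => [|A x B y [mA Ax] [mB By]|t _].
  - by split; [exact: measurable0 | rewrite measure0].
  - split; first exact: measurableU.
    by apply: le_trans (measureU2 _ _ _) _ => //; exact: leeD.
  - by split; [exact: measurable_sample_eq | exact: lexx].
move/le_trans; apply.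
under eq_bigr do rewrite prob_sample_eq.
rewrite sumEFin lee_fin mulr_sumr big_mkcond /=.
have c0 : 0 <= #|V|%:R ^- n :> R by rewrite invr_ge0 exprn_ge0.
apply: ler_sum => t _; case: ifP => [Tt|_]; last by rewrite mulr_ge0.
by rewrite ler_peMr// h1.
Qed.

End sample_law.

Lemma mul_div_continuity (R : realType) (x y z eps : R) :
  z != 0 -> 0 < eps ->
  exists2 delta : R, 0 < delta & forall x' y' z' : R,
    `|x' - x| < delta -> `|y' - y| < delta -> `|z' - z| < delta ->
    `|x' * y' / z' - x * y / z| <= eps.
Proof.
move=> z0 eps0.
pose f (p : R * R * R) : R := p.1.1 * p.1.2 / p.2.
have : (f q @[q --> ((x, y, z) : R * R * R)] --> x * y / z)%classic.
  apply: cvgM; last by apply: cvgV => //; exact: cvg_snd.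
  apply: cvgM; apply: (cvg_comp _ _ (@cvg_fst _ _ _ _ _)).
  - exact: cvg_fst.
  - exact: cvg_snd.
move=> /cvgrPdist_le/(_ _ eps0)/nbhs_ballP[delta delta0 H].
exists delta => // x' y' z' hx hy hz; rewrite distrC.
by apply: (H (x', y', z')); do ?split; rewrite /ball/= distrC.
Qed.

Lemma star_sizeE (R : realType) (V : finType) (e : rel V) (A : {set V}) n
    (t : n.-tuple V) : (0 < n)%N ->
  star_size R e A t = #|V|%:R *
    ((\sum_(v <- t) #|neighbors e v :&: A|%:R) / n%:R
     * ((\sum_(v <- t) (v \in A)%:R) / n%:R)
     / ((\sum_(v <- t) (if v \in A then deg e v else 0%N)%:R) / n%:R)).
Proof.
move=> n0; rewrite /star_size /fvol_hat /mean_deg /sample_vol /sample_in.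
rewrite size_tuple size_filter big_filter -!natr_sum.
rewrite -[(\sum_(v <- t) if _ then _ else _)%N]big_mkcond /=.
rewrite -sum1_count [(\sum_(v <- t | v \in A) 1)%N]big_mkcond /=.
have -> : (\sum_(v <- t) (if v \in A then 1 else 0) = \sum_(v <- t) (v \in A))%N.
  by [].
have -> : (\sum_(u <- t) \sum_(v in neighbors e u) (v \in A : nat)
    = \sum_(u <- t) #|neighbors e u :&: A|)%N.
  apply: eq_bigr => u _; rewrite -sum1_card.
  under [RHS]eq_bigl do rewrite inE.
  by rewrite [RHS]big_mkcondr /=; apply: eq_bigr => v _; case: ifP.
set E := (\sum_(u <- t) #|_ :&: _|)%N.
set D := (\sum_(u <- t) deg e u)%N.
have ED : (E <= D)%N.
  by apply: leq_sum => u _; rewrite subset_leq_card// subsetIl.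
set Y := (\sum_(u <- t) (u \in A))%N.
set Z := (\sum_(u <- t | _) deg e u)%N.
have nN : n%:R != 0 :> R by rewrite pnatr_eq0 -lt0n.
(* If vol(S) = 0, then [ED] makes the numerator vanish too, and both sides are 0. *)
have [D0|D0] := posnP D.
  by move: ED; rewrite D0 leqn0 => /eqP ->; rewrite !(mul0r, mulr0).
have DN : D%:R != 0 :> R by rewrite pnatr_eq0 -lt0n.
(* These inversion rules hold at 0 as well. Keeping the inverse of [Z] as an atom then lets [field]
   work even when [Z] or [Y] is 0, for instance when no draw falls in [A]. *)
rewrite !invfM !invrK.
set y := Y%:R; set z := (Z%:R)^-1; set E' := E%:R.
by field; rewrite nN DN.
Qed.

(** Double counting of the pairs [(v, u)] with [e v u] and [u] in [A]; symmetry turns the count over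
    [v] into the degree of [u]. *)
Lemma sum_card_neighborsI (V : finType) (e : rel V) (A : {set V}) :
  symmetric e -> (\sum_v #|neighbors e v :&: A| = vol e A)%N.
Proof.
move=> sym_e; rewrite /vol /deg.
under eq_bigr => v _.
  rewrite -sum1_card; under eq_bigl do rewrite !inE andbC.
  rewrite big_mkcondr /=; over.
rewrite exchange_big /=; apply: eq_bigr => u _.
rewrite -big_mkcond /= sum1dep_card; apply: eq_card => v.
by rewrite !inE sym_e.
Qed.

Theorem mainTheorem2 (R : realType) (d : measure_display)
    (Omega : measurableType d) (P : probability Omega R)
    (V : finType) (e : rel V) (C : {set {set V}}) (A : {set V})
    (S : forall n : nat, Omega -> n.-tuple V) :
  symmetric e ->
  finset.partition C [set: V]%SET ->
  A \in C ->
  (0 < vol e A)%N ->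
  (forall n : nat, uniform_independence_sample P (S n)) ->
  cvg_in_probability P (fun n w => star_size R e A (S n w)) #|A|%:R.
Proof.
move=> sym_e _ _ volA US eps eps0.
have V0 : (0 < #|V|)%N.
  rewrite lt0n; apply: contraL volA => /eqP V0; rewrite -leqNgt leqn0.
  by apply/eqP; apply: big1 => v; have := max_card (pred1 v); rewrite V0 card1.
have VN : #|V|%:R != 0 :> R by rewrite pnatr_eq0 -lt0n.
have Vgt0 : 0 < #|V|%:R :> R by rewrite ltr0n.
have volN : (vol e A)%:R != 0 :> R by rewrite pnatr_eq0 -lt0n.
pose g1 v : R := #|neighbors e v :&: A|%:R.
pose g2 v : R := (v \in A)%:R.
pose g3 v : R := (if v \in A then deg e v else 0%N)%:R.
pose x : R := (vol e A)%:R / #|V|%:R.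
pose y : R := #|A|%:R / #|V|%:R.
have xE : x = (\sum_v g1 v) / #|V|%:R.
  by rewrite /g1 -natr_sum sum_card_neighborsI.
have yE : y = (\sum_v g2 v) / #|V|%:R.
  by rewrite /g2 -natr_sum /y -[#|A|]sum1_card big_mkcond.
have zE : x = (\sum_v g3 v) / #|V|%:R.
  by rewrite /g3 -natr_sum -big_mkcond.
have x0 : x != 0 by rewrite mulf_neq0// invr_eq0.
(* The tolerance is [eps / #|V|%:R] because [star_sizeE] has [#|V|%:R] as an outer factor. *)
have [delta delta0 Hdelta] :=
  mul_div_continuity x y x0 (divr_gt0 eps0 Vgt0).
(* The means of [g1] and [g3] share the limit [x], which cancels because vol(A) is positive. *)
have limE : #|A|%:R = #|V|%:R * (x * y / x).
  by rewrite mulrAC divff// mul1r /y mulrC divfK.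
pose dev n (g : V -> R) (m : R) (t : n.-tuple V) :=
  (\sum_(v <- t) g v) / n%:R - m.
pose var (g : V -> R) (m : R) := (\sum_v (g v - m) ^+ 2) / #|V|%:R.
pose K := (var g1 x + var g2 y + var g3 x) / delta ^+ 2.
have bound n : (0 < n)%N ->
    (P [set w | (eps < `|star_size R e A (S n w) - #|A|%:R|)%R]%classic
     <= (K / n%:R)%:E)%E.
  move=> n0.
  (* Where [h] is below 1, all three deviations are below [delta], so the estimator is within [eps]
     of its limit; hence [h] is at least 1 on the bad event. Its average over tuples is exactly
     [K / n%:R]. *)
  pose h (t : n.-tuple V) : R :=
    (dev n g1 x t ^+ 2 + dev n g2 y t ^+ 2 + dev n g3 x t ^+ 2) / delta ^+ 2.
  have := prob_sample_le (US n)
    (T := fun t => eps < `|star_size R e A t - #|A|%:R|) (h := h).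
  have -> : #|V|%:R ^- n * (\sum_t h t) = K / n%:R.
    rewrite /h -mulr_suml !big_split /= mulrA !mulrDr.
    rewrite !sum_tuple_sqr_dev// /K /var.
    by rewrite -!mulrDl [LHS]mulrAC.
  apply=> t; first by rewrite divr_ge0 ?addr_ge0 ?sqr_ge0.
  rewrite star_sizeE// limE -mulrBr normrM (ger0_norm (ltW Vgt0)).
  rewrite mulrC -ltr_pdivrMr// => bad.
  rewrite ler_pdivlMr ?exprn_gt0// mul1r leNgt; apply/negP => small.
  have sq_lt (a b c : R) :
      a ^+ 2 + b ^+ 2 + c ^+ 2 < delta ^+ 2 -> `|a| < delta.
    move=> abc; rewrite -(ltr_pXn2r (ltn0Sn 1)) ?nnegrE ?(ltW delta0)//.
    rewrite real_normK ?num_real//.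
    by have := sqr_ge0 b; have := sqr_ge0 c; lra.
  move: bad; apply/negP; rewrite -leNgt; apply: Hdelta.
  - exact: sq_lt small.
  (* [sq_lt] bounds the first summand, so the sum is permuted to bring the relevant square to the
     front. *)
  - by apply: sq_lt; rewrite [X in X + _]addrC; exact: small.
  - by apply: sq_lt; rewrite addrC addrA in small; exact: small.
apply: (@squeeze_cvge _ _ _ _ (cst 0%E) _ (fun n => (K / n%:R)%:E)).
- near=> n; rewrite measure_ge0 /=; apply: bound.
  by near: n; exact: nbhs_infty_gt.
- exact: cvg_cst.
- apply: cvg_EFin; first by near=> n.
  (* The harmonic sequence is [1 / (n + 1)], hence the index shift by [cvg_shiftS]. *)
  have lim0 := cvgM (cvg_cst K) (@cvg_harmonic R).
  by rewrite mulr0 in lim0; rewrite -cvg_shiftS; exact: lim0.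
Unshelve. all: by end_near.
Qed.
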